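(* Let $\Gamma$ be a planning context, let $P, Q$ be ground states and $f$ a plan such that $\Gamma \vdash \{P\} \leadsto \{Q\} \mid f$ is derivable by the rules of the PCP logic. Then for every world $w \in \langle w_P\rangle$ and every action handler $\delta$ that is well-formed (with respect to $\Gamma$), we have $[\![f]\!]^{\delta}\, w \in \langle w_Q\rangle$.
   Context: **Syntax.** Fix a set of predicate symbols $R$ with arities, a set $X$ of variables, a set $C$ of constants, and a set of action names $\alpha$ (with arities). A term is a variable or a constant. An atom is $A ::= R(t_1,\dots,t_n)$ with $t_i$ terms. A constraint is $t = t'$ or $t \neq t'$ with $t,t'$ terms; a constraint list $\phi$ is a finite list of constraints. An action is an action name applied to terms, $a ::= \alpha(t_1,\dots,t_n)$. Plans are given by $f ::= \mathit{shrink} \mid a \mid f;f_1$ (the actions in plans are ground). Polarities are $z \in \{+,-\}$. A state is a finite list of formula maps: $P ::= \mathit{emp} \mid A\mapsto z \mid P*Q$, where $*$ is list concatenation with unit $\mathit{emp}$. Write $A \mapsto z\in P$ for list membership, and $A\notin P$ if neither $A\mapsto +$ nor $A\mapsto -$ is in $P$. $\mathit{emp}$ is valid, and $A\mapsto z * P$ is valid iff $A \notin P$ and $P$ is valid. ''Ground'' means containing no variables. $[\sigma]$ denotes application of a ground substitution $\sigma$ (a map from variables to constants, defined on all variables concerned). **Context.** A planning context $\Gamma$ is a set of action descriptions $\phi(\overline x);\{P(\overline x)\}\leadsto\{Q(\overline x)\}\mid \alpha(\overline x)$, where $\overline x$ is a list of distinct variables, all variables of $\phi,P,Q$ are among $\overline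 x$, and each action name $\alpha$ has at most one description in $\Gamma$. **Constraint normalisation.** $\mathit{norm}\,[]=\top$; $\mathit{norm}(t=t_1::\phi)$ is $\mathit{norm}\,\phi$ if $t,t_1$ are syntactically equal and $\bot$ otherwise; $\mathit{norm}(t\ne t_1::\phi)$ is $\bot$ if $t,t_1$ are syntactically equal and $\mathit{norm}\,\phi$ otherwise. ''$\phi$ normalises to $\top$'' means $\mathit{norm}\,\phi=\top$. **Subtyping** $<:$ on states is inductively defined by: $S <: \mathit{emp}$; and if $S' <: S$ and $A\mapsto z\in S'$ then $S' <: A\mapsto z * S$. **Override.** $P\sqcup \mathit{emp}=P$; $P\sqcup(A\mapsto z * Q) = (A\mapsto z * (P\setminus\{A\mapsto +, A\mapsto -\}))\sqcup Q$, where $P\setminus\{\dots\}$ removes all occurrences of the listed maps. **Rules of the PCP logic** (deriving $\Gamma\vdash\{P\}\leadsto\{Q\}\mid f$ with $P,Q$ ground; all states occurring in rules must be valid): - ApplyAction: if $\phi(\overline x);\{P(\overline x)\}\leadsto\{Q(\overline x)\}\mid\alpha(\overline x)\in\Gamma$, $\sigma$ is a ground substitution and $\phi(\overline x)[\sigma]$ normalises to $\top$, then $\Gamma\vdash\{P(\overline x)[\sigma]\}\leadsto\{Q(\overline x)[\sigma]\}\mid\alpha(\overline x)[\sigma]$. - Frame: if $\Gamma\vdash\{P\}\leadsto\{Q\}\mid a$ with $a$ a single action, and $A\notin P$, $A\notin Q$, then $\Gamma\vdash\{P*A\mapsto z\}\leadsto\{Q*A\mapsto z\}\mid a$. - Weakening: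 if $P'<:P$ and $\Gamma\vdash\{P\}\leadsto\{Q\}\mid f$ then $\Gamma\vdash\{P'\}\leadsto\{Q\}\mid f$. - Shrink: if $Q<:Q'$ and $\Gamma\vdash\{P\}\leadsto\{Q\}\mid f$ then $\Gamma\vdash\{P\}\leadsto\{Q'\}\mid f;\mathit{shrink}$. - Composition: if $Q<:Q'$, $\Gamma\vdash\{P\}\leadsto\{Q\}\mid f$ and $\Gamma\vdash\{Q'\}\leadsto\{R\}\mid f_1$ then $\Gamma\vdash\{P\}\leadsto\{R\}\mid f;f_1$. **Worlds.** A world $w$ is a set of ground atoms. For a ground state $S$, $\langle w_S\rangle$ is the set of worlds $w$ (well-formed worlds for $S$) that contain every $A$ with $A\mapsto +\in S$ and contain no $A$ with $A\mapsto -\in S$. **Action handlers and evaluation.** An action handler $\delta$ is a function taking a ground action and a world to a world. Evaluation of plans: $[\![\mathit{shrink}]\!]^\delta w = w$; $[\![a]\!]^\delta w=\delta\,a\,w$; $[\![f;f_1]\!]^\delta w=[\![f_1]\!]^\delta([\![f]\!]^\delta w)$. $\delta$ is well-formed (with respect to $\Gamma$) if for every $\phi(\overline x);\{P'(\overline x)\}\leadsto\{Q(\overline x)\}\mid\alpha(\overline x)\in\Gamma$, every ground substitution $\sigma$ such that $\phi(\overline x)[\sigma]$ normalises to $\top$, every ground state $P$ with $P<:P'(\overline x)[\sigma]$ (all states $P$, $P'(\overline x)[\sigma]$, $Q(\overline x)[\sigma]$ being valid), and every $w\in\langle w_P\rangle$, we have $\delta\,(\alpha(\overline x)[\sigma])\,w\in\langle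 w_{P\sqcup Q(\overline x)[\sigma]}\rangle$. *)

(* Defs.v *)
From HB Require Import structures.
From mathcomp Require Import all_boot.
From mathcomp Require Import classical_sets.

Set Implicit Arguments.
Unset Strict Implicit.
Unset Printing Implicit Defensive.

Record signature := Signature {
  predsym : eqType;
  pred_arity : predsym -> nat;
  variable : eqType;
  constant : eqType;
  actname : Type;
  act_arity : actname -> nat
}.

Inductive term (Sg : signature) : Type :=
  | Var of variable Sg
  | Const of constant Sg.
Arguments Var {Sg} _.
Arguments Const {Sg} _.

Definition sum_of_term (Sg : signature) (t : term Sg) :
    (variable Sg + constant Sg)%type :=
  match t with Var x => inl x | Const c => inr c end.
Definition term_of_sum (Sg : signature)
    (s : (variable Sg + constant Sg)%type) : term Sg :=
  match s with inl x => Var x | inr c => Const c end.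
Lemma sum_of_termK (Sg : signature) :
  cancel (@sum_of_term Sg) (@term_of_sum Sg).
Proof. by case. Qed.
HB.instance Definition _ (Sg : signature) :=
  Equality.copy (term Sg) (can_type (@sum_of_termK Sg)).

(* A symbol applied to as many terms as its arity; both atoms and actions are
   of this form. *)
Definition application (Sg : signature) (F : Type) (ar : F -> nat) : Type :=
  {g : F & (ar g).-tuple (term Sg)}.

Definition atom (Sg : signature) : Type := application Sg (@pred_arity Sg).

Definition action (Sg : signature) : Type := application Sg (@act_arity Sg).

Inductive polarity : Type := Plus | Minus.
Definition bool_of_polarity (z : polarity) : bool :=
  if z is Plus then true else false.
Definition polarity_of_bool (b : bool) : polarity := if b then Plus else Minus.
Lemma bool_of_polarityK : cancel bool_of_polarity polarity_of_bool.
Proof. by case. Qed.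
HB.instance Definition _ := Equality.copy polarity (can_type bool_of_polarityK).

Definition state (Sg : signature) : Type := seq (atom Sg * polarity).

Inductive constraint (Sg : signature) : Type :=
  | CEq of term Sg & term Sg
  | CNeq of term Sg & term Sg.
Arguments CEq {Sg} _ _.
Arguments CNeq {Sg} _ _.

Definition term_vars (Sg : signature) (t : term Sg) : seq (variable Sg) :=
  match t with Var x => [:: x] | Const _ => [::] end.
Definition app_vars (Sg : signature) (F : Type) (ar : F -> nat)
    (a : application Sg ar) : seq (variable Sg) :=
  flatten [seq term_vars t | t <- tagged a].
Definition constraint_vars (Sg : signature) (c : constraint Sg) :
    seq (variable Sg) :=
  match c with CEq t u | CNeq t u => term_vars t ++ term_vars u end.
Definition state_vars (Sg : signature) (S : state Sg) : seq (variable Sg) :=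
  flatten [seq app_vars m.1 | m <- S].

Definition ground_app (Sg : signature) (F : Type) (ar : F -> nat)
  (a : application Sg ar) : bool := nilp (app_vars a).
Definition ground_state (Sg : signature) (S : state Sg) : bool :=
  nilp (state_vars S).

Definition gatom (Sg : signature) : Type := {A : atom Sg | ground_app A}.
Definition gaction (Sg : signature) : Type := {a : action Sg | ground_app a}.

(* Substitutions are partial, so that the empty substitution exists even when
   there are variables but no constants; [subst_defined] says that all the
   variables concerned are in the domain. Outside its domain a substitution
   leaves variables unchanged. *)
Definition substitution (Sg : signature) : Type :=
  variable Sg -> option (constant Sg).
Definition subst_defined (Sg : signature) (sigma : substitution Sg)
  (xs : seq (variable Sg)) : bool := all (fun x => isSome (sigma x)) xs.
Definition subst_term (Sg : signature) (sigma : substitution Sg)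
    (t : term Sg) : term Sg :=
  match t with
  | Var x => if sigma x is Some c then Const c else Var x
  | Const c => Const c
  end.
Definition subst_app (Sg : signature) (F : Type) (ar : F -> nat)
    (sigma : substitution Sg) (a : application Sg ar) : application Sg ar :=
  existT _ (tag a) (map_tuple (subst_term sigma) (tagged a)).
Definition subst_constraint (Sg : signature) (sigma : substitution Sg)
    (c : constraint Sg) : constraint Sg :=
  match c with
  | CEq t u => CEq (subst_term sigma t) (subst_term sigma u)
  | CNeq t u => CNeq (subst_term sigma t) (subst_term sigma u)
  end.
Definition subst_constraints (Sg : signature) (sigma : substitution Sg)
    (phi : seq (constraint Sg)) : seq (constraint Sg) :=
  [seq subst_constraint sigma c | c <- phi].
Definition subst_state (Sg : signature) (sigma : substitution Sg)
    (S : state Sg) : state Sg :=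
  [seq (subst_app sigma m.1, m.2) | m <- S].

(* [true] stands for top and [false] for bottom. *)
Fixpoint norm (Sg : signature) (phi : seq (constraint Sg)) : bool :=
  match phi with
  | [::] => true
  | CEq t u :: phi' => if t == u then norm phi' else false
  | CNeq t u :: phi' => if t == u then false else norm phi'
  end.

Definition absent (Sg : signature) (A : atom Sg) (P : state Sg) : bool :=
  ((A, Plus) \notin P) && ((A, Minus) \notin P).

Fixpoint valid (Sg : signature) (P : state Sg) : bool :=
  if P is (A, _) :: P' then absent A P' && valid P' else true.

Inductive subtype (Sg : signature) : state Sg -> state Sg -> Prop :=
  | subtype_emp S : subtype S [::]
  | subtype_cons S' S A z :
      subtype S' S -> (A, z) \in S' -> subtype S' ((A, z) :: S).

Fixpoint override (Sg : signature) (P Q : state Sg) : state Sg :=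
  if Q is (A, z) :: Q' then
    override ((A, z) :: [seq m <- P | m \notin [:: (A, Plus); (A, Minus)]]) Q'
  else P.

Record description (Sg : signature) : Type := Description {
  descr_name : actname Sg;
  descr_params : (act_arity descr_name).-tuple (variable Sg);
  descr_constraints : seq (constraint Sg);
  descr_pre : state Sg;
  descr_post : state Sg
}.

Definition descr_action (Sg : signature) (d : description Sg) : action Sg :=
  existT _ (descr_name d) (map_tuple (@Var Sg) (descr_params d)).

Definition wf_description (Sg : signature) (d : description Sg) : Prop :=
  [/\ uniq (descr_params d),
      {subset flatten [seq constraint_vars c | c <- descr_constraints d]
         <= descr_params d},
      {subset state_vars (descr_pre d) <= descr_params d} &
      {subset state_vars (descr_post d) <= descr_params d}].

Definition planning_context (Sg : signature) (Gamma : set (description Sg)) :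
    Prop :=
  (forall d, Gamma d -> wf_description d) /\
  (forall d d', Gamma d -> Gamma d' -> descr_name d = descr_name d' -> d = d').

Inductive plan (Sg : signature) : Type :=
  | Shrink
  | Act of gaction Sg
  | Seq of plan Sg & plan Sg.
Arguments Shrink {Sg}.

Definition vground (Sg : signature) (P : state Sg) : bool :=
  ground_state P && valid P.

(* Every state occurring in a derivable judgement is ground and valid; side
   conditions are imposed only on states that are not already part of a
   derivable premise. *)
Inductive derivable (Sg : signature) (Gamma : set (description Sg)) :
    state Sg -> state Sg -> plan Sg -> Prop :=
  | ApplyAction (d : description Sg) (sigma : substitution Sg)
      (a : gaction Sg) :
      Gamma d ->
      subst_defined sigma (descr_params d) ->
      norm (subst_constraints sigma (descr_constraints d)) ->
      valid (descr_pre d) ->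
      valid (descr_post d) ->
      vground (subst_state sigma (descr_pre d)) ->
      vground (subst_state sigma (descr_post d)) ->
      val a = subst_app sigma (descr_action d) ->
      derivable Gamma (subst_state sigma (descr_pre d))
        (subst_state sigma (descr_post d)) (Act a)
  | Frame (P Q : state Sg) (a : gaction Sg) (A : atom Sg) (z : polarity) :
      derivable Gamma P Q (Act a) ->
      absent A P ->
      absent A Q ->
      vground (P ++ [:: (A, z)]) ->
      vground (Q ++ [:: (A, z)]) ->
      derivable Gamma (P ++ [:: (A, z)]) (Q ++ [:: (A, z)]) (Act a)
  | Weakening (P P' Q : state Sg) (f : plan Sg) :
      vground P' ->
      subtype P' P ->
      derivable Gamma P Q f ->
      derivable Gamma P' Q f
  | ShrinkRule (P Q Q' : state Sg) (f : plan Sg) :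
      vground Q' ->
      subtype Q Q' ->
      derivable Gamma P Q f ->
      derivable Gamma P Q' (Seq f Shrink)
  | Composition (P Q Q' R : state Sg) (f f1 : plan Sg) :
      subtype Q Q' ->
      derivable Gamma P Q f ->
      derivable Gamma Q' R f1 ->
      derivable Gamma P R (Seq f f1).

Definition world (Sg : signature) : Type := set (gatom Sg).

Definition wf_worlds (Sg : signature) (S : state Sg) : set (world Sg) :=
  [set w : world Sg |
     (forall A : gatom Sg, (val A, Plus) \in S -> w A) /\
     (forall A : gatom Sg, (val A, Minus) \in S -> ~ w A)]%classic.

Definition handler (Sg : signature) : Type :=
  gaction Sg -> world Sg -> world Sg.

Fixpoint eval (Sg : signature) (delta : handler Sg) (f : plan Sg)
    (w : world Sg) : world Sg :=
  match f with
  | Shrink => w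
  | Act a => delta a w
  | Seq f1 f2 => eval delta f2 (eval delta f1 w)
  end.

Definition wf_handler (Sg : signature) (Gamma : set (description Sg))
    (delta : handler Sg) : Prop :=
  forall (d : description Sg) (sigma : substitution Sg) (P : state Sg)
         (w : world Sg) (a : gaction Sg),
    Gamma d ->
    subst_defined sigma (descr_params d) ->
    norm (subst_constraints sigma (descr_constraints d)) ->
    ground_state P ->
    subtype P (subst_state sigma (descr_pre d)) ->
    valid P ->
    valid (subst_state sigma (descr_pre d)) ->
    valid (subst_state sigma (descr_post d)) ->
    wf_worlds P w ->
    val a = subst_app sigma (descr_action d) ->
    wf_worlds (override P (subst_state sigma (descr_post d))) (delta a w).

(* Main.v *)
Require Import Defs.
From mathcomp Require Import all_boot.
From mathcomp Require Import classical_sets.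

(** Soundness is immediate by induction on derivations except for Frame, whose
    premise says nothing about the value of the framed atom after the action.
    A derivation of {P} ~> {Q} | a for a single action a, however, only uses
    ApplyAction, Frame and Weakening, so it comes from one instance
    {pre} ~> {post} of a description such that pre is included in P, post in Q,
    and Q in the override of P by post. The inclusion of post in Q makes this
    invariant stable under Frame: a framed atom absent from Q is absent from
    post, hence is not overridden. Well-formedness of the handler, applied to
    the whole of P, then concludes. *)

Lemma absentE (Sg : signature) (A : atom Sg) (P : state Sg) :
  absent A P = (A \notin unzip1 P).
Proof.
rewrite /absent -negb_or; congr (~~ _).
apply/orP/mapP => [[AP|AP]|[[B [] BP] /= ->]]; try by [left|right].
- by exists (A, Plus).
- by exists (A, Minus).
Qed.

Lemma subtype_sub (Sg : signature) (S S' : state Sg) :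
  subtype S S' -> {subset S' <= S}.
Proof.
elim=> {S S'} [S m //|S' S A z _ sub AS m].
by rewrite inE => /predU1P[->|/sub].
Qed.

(** Turns the inclusions of [derivable_act] into the [subtype] premise of [wf_handler]. *)
Lemma sub_subtype (Sg : signature) (S S' : state Sg) :
  {subset S' <= S} -> subtype S S'.
Proof.
elim: S' => [|[A z] S' IH] sub; first exact: subtype_emp.
apply: subtype_cons; last by apply: sub; rewrite mem_head.
by apply: IH => m mS'; apply: sub; rewrite inE mS' orbT.
Qed.

Lemma wf_worlds_sub (Sg : signature) (S S' : state Sg) (w : world Sg) :
  {subset S' <= S} -> wf_worlds S w -> wf_worlds S' w.
Proof. by move=> sub [pos neg]; split=> A /sub; [apply: pos|apply: neg]. Qed.

(** An entry of [Q], once placed, could be erased only by a later entry of [Q] with the same atom,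
    which validity rules out. *)
Lemma mem_override (Sg : signature) (P Q : state Sg) (m : atom Sg * polarity) :
  valid Q ->
  (m \in override P Q) = (m \in Q) || (m \in P) && (m.1 \notin unzip1 Q).
Proof.
elim: Q P m => [|[A z] Q IH] P m /=; first by rewrite andbT.
rewrite absentE => /andP[AQ vQ]; rewrite IH // !inE mem_filter.
have ->: (m \notin [:: (A, Plus); (A, Minus)]) = (m.1 != A).
  by case: m => B []; rewrite !inE !xpair_eqE /= ?andbT ?andbF ?orbF.
case: eqVneq => [->|_] /=; first by rewrite AQ orbT.
by case: (m.1 == A); case: (m.1 \in unzip1 Q); case: (m \in P);
  rewrite ?orbT ?orbF.
Qed.

(** Supplies the groundness and validity of [P] that [wf_handler] requires. *)
Lemma derivable_vground (Sg : signature) (Gamma : set (description Sg))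
    (P Q : state Sg) (f : plan Sg) :
  derivable Gamma P Q f -> vground P /\ vground Q.
Proof.
elim=> {P Q f} //.
- by move=> P P' Q f gP' _ _ [].
- by move=> P Q Q' f gQ' _ _ [].
- by move=> P Q Q' R f f1 _ _ [gP _] _ [_ gR].
Qed.

Lemma derivable_act (Sg : signature) (Gamma : set (description Sg))
    (P Q : state Sg) (a : gaction Sg) :
  derivable Gamma P Q (Act a) ->
  exists (d : description Sg) (sigma : substitution Sg),
    let pre := subst_state sigma (descr_pre d) in
    let post := subst_state sigma (descr_post d) in
    [/\ Gamma d, subst_defined sigma (descr_params d),
        norm (subst_constraints sigma (descr_constraints d)),
        val a = subst_app sigma (descr_action d) &
        [/\ valid pre, valid post, {subset pre <= P}, {subset post <= Q} &
            {subset Q <= override P post}]].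
Proof.
move: {-2}(Act a) (erefl (Act a)) => f ef der; elim: der ef => {P Q f} //.
- move=> d sigma b Gd sd nd _ _ /andP[_ vpre] /andP[_ vpost] eb [eba].
  exists d, sigma; rewrite -eba; split=> //; split=> // m mQ.
  by rewrite mem_override // mQ.
- move=> P Q b A z _ IH _ AQ _ _ /IH[d [sigma []]].
  move=> Gd sd nd ea [vpre vpost preP postQ Qov].
  exists d, sigma; split=> //; split=> // m.
  + by rewrite mem_cat => /preP->.
  + by rewrite mem_cat => /postQ->.
  rewrite mem_override // !mem_cat => /orP[/Qov|]; rewrite ?mem_override //.
    by case/orP=> [->//|/andP[-> ->]]; rewrite orbT.
  rewrite inE => /eqP->; rewrite eqxx orbT /=; apply/orP; right.
  apply: contraNN (_ : A \notin unzip1 Q); last by rewrite -absentE.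
  by case/mapP=> n /postQ nQ ->; apply: map_f.
- move=> P P' Q f _ /subtype_sub PP' _ IH /IH[d [sigma []]].
  move=> Gd sd nd ea [vpre vpost preP postQ Qov].
  exists d, sigma; split=> //; split=> // m; first by move/preP/PP'.
  (* Weakening keeps [post] and only enlarges the state being overridden. *)
  move/Qov; rewrite !mem_override //.
  by case/orP=> [->//|/andP[/PP'-> ->]]; rewrite orbT.
Qed.

Lemma derivable_act_sound (Sg : signature) (Gamma : set (description Sg))
    (P Q : state Sg) (a : gaction Sg) (w : world Sg) (delta : handler Sg) :
  wf_handler Gamma delta -> derivable Gamma P Q (Act a) ->
  wf_worlds P w -> wf_worlds Q (delta a w).
Proof.
move=> hdelta der wP; have [/andP[gP vP] _] := derivable_vground _ _ _ _ _ der.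
have [d [sigma [Gd sd nd ea [vpre vpost preP _ Qov]]]] :=
  derivable_act _ _ _ _ _ der.
apply: wf_worlds_sub Qov _; apply: hdelta => //; exact: sub_subtype.
Qed.

Theorem theorem11 (Sg : signature) (Gamma : set (description Sg))
    (hGamma : planning_context Gamma) (P Q : state Sg)
    (hP : ground_state P) (hQ : ground_state Q) (f : plan Sg)
    (hder : derivable Gamma P Q f)
    (w : world Sg) (hw : wf_worlds P w)
    (delta : handler Sg) (hdelta : wf_handler Gamma delta) :
  wf_worlds Q (eval delta f w).
Proof.
elim: hder w hw {hP hQ} => {P Q f}.
- move=> d sigma a Gd sd nd vd vd' gpre gpost ea w.
  by apply: derivable_act_sound hdelta _; exact: ApplyAction.
(* The induction hypothesis is dropped: the framed judgement is rebuilt and treated as a whole,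
   being again one for a single action. *)
- move=> P Q a A z der _ AP AQ gP gQ w; apply: derivable_act_sound hdelta _.
  exact: Frame.
- move=> P P' Q f _ /subtype_sub PP' _ IH w wP'.
  exact: IH (wf_worlds_sub _ _ _ _ PP' wP').
- move=> P Q Q' f _ /subtype_sub QQ' _ IH w /IH; exact: wf_worlds_sub.
- move=> P Q Q' R f f1 /subtype_sub QQ' _ IH _ IH1 w wP /=.
  exact: IH1 (wf_worlds_sub _ _ _ _ QQ' (IH _ wP)).
Qed.
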